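(* Let $G$ be a ribbon graph, and let $\rho\in\{\delta\tau,\delta\tau\delta\}$. Then there exists a spanning quasi-tree $Q$ of $G$ such that, writing $E(Q)$ for its edge set, $$\varepsilon(G^{\rho|E(Q)})=\varepsilon_M^{\rho}(G),\qquad\text{where } \varepsilon_M^{\rho}(G)=\max_{B\subseteq E(G)}\varepsilon(G^{\rho|B}).$$
   Context: A (finite) ribbon graph $G$ with vertex set $V(G)$ and edge set $E(G)$ is a compact surface with boundary, possibly non-orientable, presented as the union of a set $V(G)$ of discs (vertices) and a set $E(G)$ of discs (edges), such that vertices and edges intersect in disjoint line segments, each such segment lies on the boundary of precisely one vertex and precisely one edge, and every edge contains exactly two such segments. If $G$ has $v$ vertices, $e$ edges, $f$ boundary components and $k$ connected components, its Euler genus is $\varepsilon(G)=2k-v+e-f$. A spanning quasi-tree of $G$ is a spanning ribbon subgraph $Q=(V(G),F)$, $F\subseteq E(G)$, whose restriction to each connected component of $G$ is connected with exactly one boundary component. Partial dual $G^{\delta|A}$, $A\subseteq E(G)$: take the boundary components of the spanning ribbon subgraph $(V(G),A)$ as curves on the surface of $G$, glue a disc to $G$ along each of these curves, and remove the interiors of all vertices of $G$; the glued discs are the vertices of $G^{\delta|A}$, and its edge set is identified with $E(G)$. Partial Petrial $G^{\tau|A}$: for each edge in $A$, detach one end of the edge from its incident vertex, give the edge a half-twist, and reattach it. Words are read left to right: $G^{\delta\tau|A}=(G^{\delta|A})^{\tau|A}$, $G^{\delta\tau\delta|A}=((G^{\delta|A})^{\tau|A})^{\delta|A}$. *)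

(* Defs.v *)
From mathcomp Require Import all_boot all_order all_algebra.

Set Implicit Arguments.
Unset Strict Implicit.
Unset Printing Implicit Defensive.

(* A ribbon graph with edge set E is encoded by the way its edge discs are
   attached.  The disc of an edge e is a rectangle with four corners
   (e, (i, s)): the end i says at which of the two line segments shared with
   vertices the corner lies, and s says on which of the two free sides of the
   rectangle it lies. *)
Definition corner (E : finType) : finType := (E * (bool * bool))%type.

(* The corners cut the boundary circle of each vertex alternately into line
   segments shared with edges and free arcs; [arc] sends a corner to the other
   endpoint of its free arc.  Any fixed-point-free involution is allowed, so
   surfaces may be non-orientable or disconnected.  The boundary of a vertex
   without edges carries no corner, hence the separate type [isolated]. *)
Record ribbon_graph (E : finType) := RibbonGraph {
  isolated : finType;
  arc : corner E -> corner E;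
  arcK : involutive arc;
  arc_neq : forall x, arc x != x
}.

Section Counting.
Variable E : finType.
Implicit Types (G : ribbon_graph E) (F : {set E}) (x : corner E).

(* The two ends of a line segment, and the two ends of a free side. *)
Definition across x : corner E := (x.1, (x.2.1, ~~ x.2.2)).
Definition along x : corner E := (x.1, (~~ x.2.1, x.2.2)).

(* One marked point is added on the boundary of each isolated vertex, so that
   vertices, components and boundary components all contain a point. *)
Definition point G : finType := (corner E + isolated G)%type.

Definition on_points G (f : corner E -> corner E) (p : point G) : point G :=
  match p with inl x => inl (f x) | inr v => inr v end.

Definition joined_by G (fs : seq (corner E -> corner E)) : rel (point G) :=
  fun p q => has (fun f => on_points f p == q) fs.

(* The classes of [connect (vertex_rel G)] are the vertices. *)
Definition vertex_rel G : rel (point G) := joined_by [:: arc G; across].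

(* Connectedness in the spanning ribbon subgraph (V(G), F). *)
Definition subgraph_rel G F : rel (point G) :=
  joined_by [:: arc G; across; fun x => if x.1 \in F then along x else x].

(* A boundary component of (V(G), F) runs along the free arcs of the vertices,
   the free sides of the edges in F, and the segments uncovered by removing the
   edges outside F. *)
Definition boundary_rel G F : rel (point G) :=
  joined_by [:: arc G; fun x => if x.1 \in F then along x else across x].

Definition num_vertices G : nat := n_comp (@vertex_rel G) predT.
Definition num_components G : nat := n_comp (@subgraph_rel G setT) predT.
Definition num_boundaries G : nat := n_comp (@boundary_rel G setT) predT.

Definition euler_genus G : int :=
  (2 * (num_components G)%:Z - (num_vertices G)%:Z + (#|E|)%:Z
   - (num_boundaries G)%:Z)%R.

(* [connect (subgraph_rel setT) p] is the connected component of G at p. *)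
Definition spanning_quasi_tree G F : Prop :=
  forall p : point G,
    n_comp (@subgraph_rel G F) (connect (@subgraph_rel G setT) p) = 1 /\
    n_comp (@boundary_rel G F) (connect (@subgraph_rel G setT) p) = 1.

End Counting.

Section Twists.
Variable E : finType.
Implicit Types (G : ribbon_graph E) (A : {set E}).

(* Renaming the corner x to (f x) while leaving the free arcs in place. *)
Lemma relabel_arcK G f : involutive f -> involutive (f \o arc G \o f).
Proof. by move=> fK x; rewrite /= fK arcK fK. Qed.

Lemma relabel_arc_neq G f :
  involutive f -> forall x, (f \o arc G \o f) x != x.
Proof.
move=> fK x /=; apply: contra (arc_neq G (f x)) => /eqP fx.
by rewrite -{2}fx fK.
Qed.

Definition relabel f (fK : involutive f) G : ribbon_graph E :=
  @RibbonGraph E (isolated G) (f \o arc G \o f)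
    (relabel_arcK G fK) (relabel_arc_neq G fK).

(* The discs glued along the boundary components of (V(G), A) meet an edge of A
   in its free sides and any other edge in its old segments; once the old
   vertices are removed, the old segments of an edge of A are free.  So the two
   coordinates of the corners of the edges in A are exchanged. *)
Definition dual_corner A (x : corner E) : corner E :=
  if x.1 \in A then (x.1, (x.2.2, x.2.1)) else x.

Lemma dual_cornerK A : involutive (dual_corner A).
Proof.
by case=> e [i s]; rewrite /dual_corner; case eA: (e \in A); rewrite /= eA.
Qed.

Definition partial_dual A G : ribbon_graph E := relabel (dual_cornerK A) G.

(* The end [true] of each edge in A is detached and reattached after a
   half-twist, which exchanges its two corners. *)
Definition petrie_corner A (x : corner E) : corner E :=
  if (x.1 \in A) && x.2.1 then across x else x.

Lemma petrie_cornerK A : involutive (petrie_corner A).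
Proof.
case=> e [i s]; rewrite /petrie_corner /across /=.
by case eA: ((e \in A) && i); rewrite /= eA ?negbK.
Qed.

Definition partial_petrial A G : ribbon_graph E :=
  relabel (petrie_cornerK A) G.

Inductive twist := Delta | Tau.

Definition apply_twist A (t : twist) G : ribbon_graph E :=
  match t with Delta => partial_dual A G | Tau => partial_petrial A G end.

(* The word is applied from left to right. *)
Definition twisted G (rho : seq twist) A : ribbon_graph E :=
  foldl (fun H t => apply_twist A t H) G rho.

Definition max_euler_genus (rho : seq twist) G : int :=
  \big[Order.max/euler_genus (twisted G rho set0)]_(B : {set E})
     euler_genus (twisted G rho B).

End Twists.

(* Main.v *)
(* Each edge has four corners, and the three ways of pairing them are exchanged
   by duals and Petrials.  Together with the free arcs, a choice of pairing at
   every edge decomposes the corners into circuits, and the vertices and the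
   boundary components of a twisted graph are the circuits of two such choices,
   while components and edges are unaffected by twisting.  Changing the pairing at
   one edge changes the number of circuits by at most one, and lowers it by one if
   the new pairing joins distinct circuits.

   For delta tau, the vertices of the twisted graph are the boundary components of
   (V(G), B).  If B is not a quasi-tree, toggling a suitable edge lowers their
   number by one while the number of boundary components of the twisted graph grows
   by at most one; so a quasi-tree attains the maximal genus.

   For delta tau delta, the boundary components do not depend on B and the vertices
   are the boundary components of (V(G), B) with all edges half-twisted; a spanning
   forest is a quasi-tree with or without half-twists, so it attains the minimum. *)

From mathcomp Require Import all_boot all_order all_algebra zify.
Require Import Defs.

Set Implicit Arguments.
Unset Strict Implicit.
Unset Printing Implicit Defensive.

Import Order.TTheory.

(** * Parity of involution-stable sets and comparison of component counts *)

Lemma even_card_involution (T : finType) (f : T -> T) (A : {set T}) :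
    {in A, forall x, f x \in A} -> {in A, forall x, f (f x) = x} ->
    {in A, forall x, f x != x} ->
  ~~ odd #|A|.
Proof.
have [n] := ubnP #|A|; elim: n A => // n IHn A An fA fK f_neq.
have [-> | [x xA]] := set_0Vmem A; first by rewrite cards0.
have fxA1 : f x \in A :\ x by rewrite !inE f_neq ?fA.
have cardA : #|A| = #|A :\ x :\ f x|.+2.
  by rewrite (cardsD1 x) xA (cardsD1 (f x) (A :\ x)) fxA1.
rewrite cardA /= negbK; apply: IHn.
- by move: An; rewrite cardA; apply: ltnW.
- move=> y; rewrite !inE => /and3P[y_fx y_x yA]; rewrite fA // andbT.
  apply/andP; split; last by apply: contra y_fx => /eqP <-; rewrite fK.
  by apply: contra y_x => /eqP fyx; rewrite -(fK y) // fyx fK.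
- by move=> y; rewrite !inE => /and3P[_ _ /fK].
- by move=> y; rewrite !inE => /and3P[_ _ /f_neq].
Qed.

Section CountingComponents.
Variables (T : finType) (e e' : rel T).
Hypotheses (sym_e : connect_sym e) (sym_e' : connect_sym e').

Lemma n_comp_le_card (D : {pred T}) :
  (forall x, exists2 y, y \in D & connect e x y) -> n_comp e T <= #|D|.
Proof.
move=> De; apply: leq_trans (leq_imset_card (fingraph.root e) D).
apply/subset_leq_card/subsetP => x /andP[/eqP rx _].
have [y yD xy] := De x; apply/imsetP; exists y => //.
by rewrite -{1}rx; apply/eqP; rewrite root_connect.
Qed.

Lemma n_comp_sub :
  subrel (connect e') (connect e) -> n_comp e T <= n_comp e' T.
Proof.
move=> sub; apply: n_comp_le_card => x; exists (fingraph.root e' x).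
  by rewrite inE /= (roots_root sym_e').
exact/sub/connect_root.
Qed.

(** The [e']-roots other than that of [y] still meet every [e]-class, because the root of [x] also
    represents the class of [y]. *)
Lemma n_comp_proper x y :
    subrel (connect e') (connect e) -> connect e x y -> ~~ connect e' x y ->
  n_comp e T < n_comp e' T.
Proof.
move=> sub exy e'xy; set r := fingraph.root e'.
have rD z : r z \in predI (roots e') (mem T) by rewrite inE /= roots_root.
rewrite [n_comp e' T](cardD1x (rD y)) add1n ltnS.
apply: n_comp_le_card => z; have [zy|nzy] := eqVneq (r z) (r y).
  exists (r x); first by apply/andP; split; [apply: rD | rewrite root_connect].
  apply: connect_trans _ (sub _ _ (connect_root e' x)).
  rewrite (connect_trans _ (etrans (sym_e _ _) exy)) // sub //.
  by rewrite -(root_connect sym_e') -/r zy.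
by exists (r z); [apply/andP; split; first apply: rD | exact/sub/connect_root].
Qed.

(** Map every [e]-root except that of [b] to its [e']-root: the hypothesis makes this injective. *)
Lemma n_comp_leS b :
    (forall x y, connect e' x y ->
      [|| connect e x y, connect e x b | connect e y b]) ->
  n_comp e T <= (n_comp e' T).+1.
Proof.
move=> sub; set r := fingraph.root e; set D := predI (roots e) (mem T).
have rD : r b \in D by rewrite inE /= roots_root.
rewrite [n_comp e T](cardD1x rD) add1n ltnS -/D.
rewrite -(@card_in_imset _ _ (fingraph.root e')).
  apply/subset_leq_card/subsetP => _ /imsetP[x _ ->].
  by rewrite inE /= roots_root.
move=> x y; move=> /andP[/= /andP[/eqP rx _] xb].
move=> /andP[/= /andP[/eqP ry _] yb] /eqP; rewrite root_connect // => /sub.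
rewrite -!(root_connect sym_e) rx ry -/r (negPf xb) (negPf yb) !orbF.
exact/eqP.
Qed.

End CountingComponents.

(** * The three pairings of the corners of an edge *)

Section Turning.
Variable E : finType.
Implicit Types (u v w : E -> bool * bool) (x y : corner E) (e : E).

(* The four corners of an edge form a torsor under (Z/2)^2, the three nonzero
   elements of which give the three ways to pair them. *)
Definition turn u x : corner E :=
  (x.1, (x.2.1 (+) (u x.1).1, x.2.2 (+) (u x.1).2)).

Lemma turnK u : involutive (turn u).
Proof. by case=> e [i s]; rewrite /turn /= !addbK. Qed.

Lemma turnC u v x : turn u (turn v x) = turn v (turn u x).
Proof. by rewrite /turn /= addbAC [X in (_, (_, X))]addbAC. Qed.

Lemma turn_neq u x : u x.1 != (false, false) -> turn u x != x.
Proof.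
case: x => e [i s]; rewrite /turn /=; case: (u e) => [[] []] //= _;
by apply/eqP; case; case: i; case: s.
Qed.

Lemma eq_turn u v x : u x.1 = v x.1 -> turn u x = turn v x.
Proof. by rewrite /turn => ->. Qed.

(** If [u] and [v] are distinct and nonzero at the edge, they form a basis of (Z/2)^2, and these are
    its four corners. *)
Variant turn_spec u v x : corner E -> Prop :=
  | TurnId : turn_spec u v x x
  | TurnLeft : turn_spec u v x (turn u x)
  | TurnRight : turn_spec u v x (turn v x)
  | TurnBoth : turn_spec u v x (turn u (turn v x)).

Lemma turnP u v x y :
    u x.1 != (false, false) -> v x.1 != (false, false) -> u x.1 != v x.1 ->
  y.1 = x.1 -> turn_spec u v x y.
Proof.
case: x => e [i s]; case: y => e' [i' s'] /= u0 v0 uv ->.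
have: [|| (i', s') == (i, s), (i', s') == (i (+) (u e).1, s (+) (u e).2),
          (i', s') == (i (+) (v e).1, s (+) (v e).2)
        | (i', s') == (i (+) (v e).1 (+) (u e).1, s (+) (v e).2 (+) (u e).2)].
  move: (u e) (v e) u0 v0 uv => [a b] [c d].
  by move: i s i' s' a b c d; do 8!case.
case/or4P=> /eqP->.
- exact: TurnId.
- exact: (TurnLeft u v (e, (i, s))).
- exact: (TurnRight u v (e, (i, s))).
- exact: (TurnBoth u v (e, (i, s))).
Qed.

Lemma across_turn : @across E =1 turn (fun=> (false, true)).
Proof. by case=> e [i s]; rewrite /turn /= addbF addbT. Qed.

Lemma along_turn : @along E =1 turn (fun=> (true, false)).
Proof. by case=> e [i s]; rewrite /turn /= addbF addbT. Qed.

Lemma across_along_turn x : across (along x) = turn (fun=> (true, true)) x.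
Proof. by case: x => e [i s]; rewrite /turn /across /along /= !addbT. Qed.

End Turning.

(** * Connectivity generated by a list of maps *)

Section Joining.
Variables (E : finType) (G : ribbon_graph E).
Implicit Types (fs : seq (corner E -> corner E)) (p q : point G).

Lemma eq_joined_by fs gs :
  all2 (fun f g => [forall x, f x == g x]) fs gs ->
  @joined_by E G fs =2 @joined_by E G gs.
Proof.
move=> fg p q; rewrite /joined_by; elim: fs gs fg => [|f fs IHfs] [|g gs] //=.
move=> /andP[/forallP fg /IHfs->]; congr (_ || _).
by case: p {IHfs} => //= x; rewrite (eqP (fg x)).
Qed.

Lemma joined_by_sym fs :
  (forall x, all (fun f => f (f x) == x) fs) -> connect_sym (@joined_by E G fs).
Proof.
move=> fsK; apply: sym_connect_sym.
have sub p q : joined_by fs p q -> joined_by fs q p.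
  rewrite /joined_by; elim: fs fsK => //= f fs IHfs fsK /orP[/eqP<-|].
    case: p {IHfs} => [x|a] /=; last by rewrite eqxx.
    by have /andP[/eqP-> _] := fsK x; rewrite eqxx.
  by move=> /IHfs->; [rewrite orbT | move=> x; case/andP: (fsK x)].
by move=> p q; apply/idP/idP; apply: sub.
Qed.

Lemma sub_joined_by fs (r : rel (point G)) :
    (forall x, all (fun f => connect r (inl x) (inl (f x))) fs) ->
  subrel (connect (@joined_by E G fs)) (connect r).
Proof.
move=> rfs; apply: connect_sub => -[x|a] q; rewrite /joined_by.
  move: (rfs x); elim: fs {rfs} => //= f fs IHfs.
  by case/andP=> rf /IHfs{}IHfs /orP[/eqP<-|].
by elim: fs {rfs} => //= f fs IHfs /orP[/eqP<-|].
Qed.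

End Joining.

(** * Circuits, and the effect of changing the pairing at one edge *)

Section Circuits.
Variables (E : finType) (G : ribbon_graph E).
Implicit Types (u v w : E -> bool * bool) (x y : corner E) (e : E).

Definition circuit_rel u : rel (point G) := @joined_by E G [:: arc G; turn u].
Definition num_circuits u : nat := n_comp (circuit_rel u) predT.

Lemma circuit_sym u : connect_sym (circuit_rel u).
Proof. by apply: joined_by_sym => x /=; rewrite arcK turnK !eqxx. Qed.

Lemma circuit_arc u x : circuit_rel u (inl x) (inl (arc G x)).
Proof. by rewrite /circuit_rel /joined_by /= eqxx. Qed.

Lemma circuit_turn u x : circuit_rel u (inl x) (inl (turn u x)).
Proof. by rewrite /circuit_rel /joined_by /= eqxx orbT. Qed.

Lemma eq_circuit_rel u v : u =1 v -> circuit_rel u =2 circuit_rel v.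
Proof.
move=> uv; apply: eq_joined_by; rewrite /= andbT; apply/andP; split.
  exact/forallP.
by apply/forallP=> x; apply/eqP; apply: eq_turn.
Qed.

Lemma eq_num_circuits u v : u =1 v -> num_circuits u = num_circuits v.
Proof. by move=> /eq_circuit_rel uv; apply/eq_n_comp/eq_connect. Qed.

(** The [u]-circuits cut open at [e]; all pairings that agree with [u] off [e] share this
    relation. *)
Definition off_edge_rel u e : rel (corner E) :=
  fun x y => (arc G x == y) || (x.1 != e) && (turn u x == y).

Lemma off_edge_sub u v e x y : (forall e', e' != e -> u e' = v e') ->
  connect (off_edge_rel u e) x y -> connect (circuit_rel v) (inl x) (inl y).
Proof.
move=> uv /connectP[p]; elim: p x => [|z p IHp] x /= => [_ -> //|].
case/andP=> xz /IHp{}IHp /IHp; apply: connect_trans; apply: connect1.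
case/orP: xz => [/eqP<-|/andP[xe /eqP<-]]; first exact: circuit_arc.
by rewrite (eq_turn (uv _ xe)); apply: circuit_turn.
Qed.

(* The component of x off the edge is a disjoint union of free arcs, and its
   corners not on the edge are paired by u; so it has an even number of
   corners on the edge. *)
Lemma off_edge_other u x : (forall e, u e != (false, false)) ->
  exists2 y, y != x & y.1 = x.1 /\ connect (off_edge_rel u x.1) x y.
Proof.
move=> u0; set e := x.1.
pose C := [set y | connect (off_edge_rel u e) x y].
pose X := [set y : corner E | y.1 == e].
have evenC : ~~ odd #|C|.
  apply: (@even_card_involution _ (arc G)) => [y|y _|y _].
  - rewrite !inE => /connect_trans; apply; apply: connect1.
    by rewrite /off_edge_rel eqxx.
  - exact: arcK.
  - exact: arc_neq.
have evenD : ~~ odd #|C :\: X|.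
  apply: (@even_card_involution _ (turn u)) => [y|y _|y _].
  - rewrite !inE => /andP[ye xy]; rewrite ye (connect_trans xy) //.
    by apply: connect1; rewrite /off_edge_rel ye eqxx orbT.
  - exact: turnK.
  - exact: turn_neq.
have: ~~ odd #|C :&: X|.
  by move: evenC; rewrite -(cardsID X) oddD (negPf evenD) addbF.
have xCX : x \in C :&: X by rewrite !inE connect0 eqxx.
rewrite (cardsD1 x) xCX /= negbK => oddCX.
have [C0|[y]] := set_0Vmem (C :&: X :\ x).
  by rewrite C0 cards0 in oddCX.
by rewrite !inE => /and3P[yx xy /eqP ye]; exists y.
Qed.

(** Off the edge, the [u]-circuit of [x] must return at [turn u x], since the two other corners lie
    on another circuit. This route survives in [v], and [turn v] links its ends to the two other
    corners. *)
Lemma merge_circuits u v x :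
    (forall e, u e != (false, false)) -> (forall e, v e != (false, false)) ->
    (forall e, e != x.1 -> u e = v e) ->
    ~~ connect (circuit_rel u) (inl x) (inl (turn v x)) ->
  subrel (connect (circuit_rel u)) (connect (circuit_rel v)).
Proof.
move=> u0 v0 uv xvx.
have uvx : u x.1 != v x.1.
  by apply: contra xvx => /eqP/eq_turn <-; apply/connect1/circuit_turn.
have vstep y : connect (circuit_rel v) (inl y) (inl (turn v y)).
  exact/connect1/circuit_turn.
have xux : connect (circuit_rel v) (inl x) (inl (turn u x)).
  have [y yx [ye xy]] := off_edge_other x u0.
  have := off_edge_sub uv xy; have := off_edge_sub (fun _ _ => erefl) xy.
  case: (turnP (u0 _) (v0 _) uvx ye) yx => //; first by rewrite eqxx.
    by move=> _ xvx'; rewrite xvx' in xvx.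
  move=> _ xuvx; case/negP: xvx; apply: connect_trans xuvx _.
  by rewrite circuit_sym; apply/connect1/circuit_turn.
apply: sub_joined_by => y /=; rewrite andbT; apply/andP; split.
  exact/connect1/circuit_arc.
have [ye|/uv/eq_turn->] := eqVneq y.1 x.1; last exact: vstep.
have uxvux : connect (circuit_rel v) (inl (turn u (turn v x))) (inl (turn u x)).
  by rewrite circuit_sym turnC; apply: vstep.
have xvx' := vstep x; rewrite circuit_sym in xux.
case: (turnP (u0 _) (v0 _) uvx ye).
- by rewrite circuit_sym.
- by rewrite turnK.
- by rewrite circuit_sym (connect_trans uxvux) // (connect_trans xux).
- by rewrite turnK (connect_trans uxvux) // (connect_trans xux).
Qed.

Lemma num_circuits_merge u v x :
    (forall e, u e != (false, false)) -> (forall e, v e != (false, false)) ->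
    (forall e, e != x.1 -> u e = v e) ->
    ~~ connect (circuit_rel u) (inl x) (inl (turn v x)) ->
  num_circuits v < num_circuits u.
Proof.
move=> u0 v0 uv xvx.
apply: (n_comp_proper (circuit_sym v) (circuit_sym u) _ _ xvx).
  exact: merge_circuits xvx.
exact/connect1/circuit_turn.
Qed.

(** Only circuits through [e] can change, and the corners of [e] lie on at most two circuits of
    [v]. *)
Lemma num_circuits_leS u v e :
    (forall e, u e != (false, false)) -> (forall e, v e != (false, false)) ->
    (forall e', e' != e -> u e' = v e') ->
  num_circuits v <= (num_circuits u).+1.
Proof.
move=> u0 v0 uv; have [eqe|neqe] := eqVneq (u e) (v e).
  rewrite (@eq_num_circuits v u) // => e'.
  by have [->|/uv] := eqVneq e' e.
(* As [u] and [v] differ at [e], [x] and [b] represent the two pairs into which [v] splits the four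
   corners. *)
pose x : corner E := (e, (false, false)); pose b := turn u x.
apply: (n_comp_leS (circuit_sym v) (circuit_sym u) (b := inl b)).
set c := connect (circuit_rel v).
have cC : symmetric c by apply: circuit_sym.
have cT := @connect_trans _ (circuit_rel v) : transitive c.
pose near p := c p (inl x) || c p (inl b).
(* A path of [u] with a turn at [e] has both ends on the [v]-circuits of [x] or [b]; if neither end
   is on that of [b], both are on that of [x]. *)
suffices sub p q : connect (circuit_rel u) p q -> c p q || near p && near q.
  move=> p q /sub; rewrite /near; case/orP=> [-> //|].
  case/andP=> /orP[px|-> _]; last by rewrite orbT.
  case/orP=> [qx|->]; last by rewrite !orbT.
  by rewrite (cT _ _ _ px) // cC.
have near_c r t : c r t -> near t -> near r.
  by move=> rt /orP[] /(cT _ _ _ rt); rewrite /near => ->; rewrite ?orbT.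
have near_edge y : y.1 = e -> near (inl y).
  move=> ye; rewrite /near; case: (turnP (u0 e) (v0 e) neqe (ye : y.1 = x.1)).
  - by rewrite /c connect0.
  - by rewrite /c connect0 orbT.
  - by rewrite cC /c connect1 // circuit_turn.
  - rewrite turnC [X in _ || X]cC /c [X in _ || X]connect1 ?orbT //.
    exact: circuit_turn.
case/connectP=> s; elim: s p => [|z s IHs] p /= => [_ ->|].
  by rewrite /c connect0.
case/andP=> pz /IHs{}IHs /IHs zq.
have: c p z || near p && near z.
  move: pz; rewrite /circuit_rel /joined_by /= orbF.
  case: p => [y|a] /=; last first.
    by rewrite orbb => /eqP<-; rewrite /c connect0.
  case/orP=> /eqP<-; first by rewrite /c connect1 // circuit_arc.
  have [ye|/uv/eq_turn->] := eqVneq y.1 e; first by rewrite !near_edge ?orbT.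
  by rewrite /c connect1 // circuit_turn.
case/orP: zq => [zq|/andP[nz nq]].
  case/orP=> [pz'|/andP[np nz]]; first by rewrite (cT _ _ _ pz' zq).
  by rewrite np (near_c q z) ?orbT // cC.
by case/orP=> [pz'|/andP[np _]]; rewrite nq ?np ?(near_c p z) ?orbT.
Qed.

End Circuits.

(** * Circuits and components under relabelling of corners *)

Section Relabelling.
Variables (E : finType) (G : ribbon_graph E).
Implicit Types (u v : E -> bool * bool) (A : {set E}).

Lemma n_comp_relabel f (fK : involutive f) fs :
    (forall x, all (fun g => g (g x) == x) fs) ->
  n_comp (@joined_by E (relabel fK G) (arc (relabel fK G) :: fs)) predT =
  n_comp (@joined_by E G (arc G :: [seq f \o g \o f | g <- fs])) predT.
Proof.
move=> fsK; have hK : involutive (@on_points E G f) by case=> //= x; rewrite fK.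
symmetry; apply: (adjunction_n_comp (on_points (G := G) f)) => //.
- apply: joined_by_sym => x /=; rewrite arcK eqxx all_map.
  by apply: sub_all (fsK (f x)) => g /= /eqP gg; rewrite fK gg fK.
- by apply: joined_by_sym => x /=; rewrite fK arcK fK eqxx fsK.
apply: strict_adjunction => //.
- by apply: joined_by_sym => x /=; rewrite fK arcK fK eqxx fsK.
- exact: inv_inj hK.
- by apply/subsetP=> p _; apply/codomP; exists (on_points f p).
move=> p q _; rewrite /joined_by /= has_map; congr (_ || _).
  rewrite -[RHS](inj_eq (inv_inj hK)); congr (_ == _).
  by case: p => //= x; rewrite fK.
apply: eq_has => g /=; rewrite -[RHS](inj_eq (inv_inj hK)); congr (_ == _).
by case: p => //= x; rewrite fK.
Qed.

Lemma num_circuits_relabel f (fK : involutive f) u v :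
  f \o turn u \o f =1 turn v -> num_circuits (relabel fK G) u = num_circuits G v.
Proof.
move=> fuv; rewrite /num_circuits /circuit_rel n_comp_relabel.
  apply/eq_n_comp/eq_connect/eq_joined_by; rewrite /= andbT.
  by apply/andP; split; apply/forallP=> x //; apply/eqP/fuv.
by move=> x /=; rewrite turnK eqxx.
Qed.

(** A basis of (Z/2)^2 at each edge: the two turns together reach all four corners. *)
Definition independent u v := forall e,
  [&& u e != (false, false), v e != (false, false) & u e != v e].

Definition pair_rel u v : rel (point G) :=
  @joined_by E G [:: arc G; turn u; turn v].

Lemma connect_pair_edge u v x y : independent u v -> y.1 = x.1 ->
  connect (pair_rel u v) (inl x) (inl y).
Proof.
move=> uv yx; have /and3P[u0 v0 neq_uv] := uv x.1.
have ustep z : pair_rel u v (inl z) (inl (turn u z)).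
  by rewrite /pair_rel /joined_by /= eqxx orbT.
have vstep z : pair_rel u v (inl z) (inl (turn v z)).
  by rewrite /pair_rel /joined_by /= eqxx !orbT.
case: (turnP u0 v0 neq_uv yx) => //; try exact: connect1.
by apply: connect_trans (connect1 (vstep _)) (connect1 (ustep _)).
Qed.

Lemma sub_connect_pair u v u' v' : independent u' v' ->
  subrel (connect (pair_rel u v)) (connect (pair_rel u' v')).
Proof.
move=> uv'; apply: sub_joined_by => x /=; rewrite andbT.
apply/and3P; split; try exact: connect_pair_edge.
by apply: connect1; rewrite /pair_rel /joined_by /= eqxx.
Qed.

(** This is why twisting preserves components: it only changes the basis at each edge. *)
Lemma eq_n_comp_pair u v u' v' : independent u v -> independent u' v' ->
  n_comp (pair_rel u v) predT = n_comp (pair_rel u' v') predT.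
Proof.
move=> uv uv'; apply: eq_n_comp => p q.
by apply/idP/idP; apply: sub_connect_pair.
Qed.

Lemma subgraph_setT_pair :
  @subgraph_rel E G setT =2 pair_rel (fun=> (false, true)) (fun=> (true, false)).
Proof.
apply: eq_joined_by; rewrite /= andbT; apply/and3P; split; apply/forallP=> x //.
  by rewrite across_turn.
by rewrite inE along_turn.
Qed.

End Relabelling.

Lemma num_components_relabel (E : finType) (G : ribbon_graph E) f
    (fK : involutive f) (u v : E -> bool * bool) :
    f \o turn (fun=> (false, true)) \o f =1 turn u ->
    f \o turn (fun=> (true, false)) \o f =1 turn v -> independent u v ->
  num_components (relabel fK G) = num_components G.
Proof.
move=> fu fv uv; rewrite /num_components.
rewrite !(eq_n_comp (eq_connect (@subgraph_setT_pair E _))).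
rewrite n_comp_relabel => [|x]; last by rewrite /= !turnK !eqxx.
rewrite -(@eq_n_comp_pair _ _ u v) //.
apply/eq_n_comp/eq_connect/eq_joined_by; rewrite /= andbT.
by apply/and3P; split; apply/forallP=> x //; apply/eqP; [apply: fu | apply: fv].
Qed.

(** * Counts of a twisted graph as circuit counts of the original *)

Section TwistedCounts.
Variables (E : finType) (G : ribbon_graph E) (A : {set E}).
Implicit Types (u : E -> bool * bool).

(** Conjugating a translation of (Z/2)^2 by a linear involution translates by the image vector. The
    dual acts by swapping coordinates, the Petrial by the shear (i, s) -> (i, i + s). *)
Definition dual_turn u e := if e \in A then ((u e).2, (u e).1) else u e.
Definition petrial_turn u e :=
  if e \in A then ((u e).1, (u e).1 (+) (u e).2) else u e.

Lemma dual_cornerJ u :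
  dual_corner A \o turn u \o dual_corner A =1 turn (dual_turn u).
Proof.
case=> e [i s]; rewrite /turn /dual_turn /dual_corner /=.
by case eA: (e \in A); rewrite /= eA.
Qed.

Lemma petrie_cornerJ u :
  petrie_corner A \o turn u \o petrie_corner A =1 turn (petrial_turn u).
Proof.
case=> e [i s]; rewrite /turn /petrial_turn /petrie_corner /across /=.
case eA: (e \in A); rewrite /= ?eA //=.
by case: i; rewrite /= ?eA /=; case: (u e) => [[] []]; case: s; rewrite ?eA.
Qed.

Lemma num_circuits_dual u :
  num_circuits (partial_dual A G) u = num_circuits G (dual_turn u).
Proof. exact/num_circuits_relabel/dual_cornerJ. Qed.

Lemma num_circuits_petrial u :
  num_circuits (partial_petrial A G) u = num_circuits G (petrial_turn u).
Proof. exact/num_circuits_relabel/petrie_cornerJ. Qed.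

Lemma num_components_dual :
  num_components (partial_dual A G) = num_components G.
Proof.
apply: num_components_relabel; try exact: dual_cornerJ.
by move=> e; rewrite /dual_turn; case: ifP.
Qed.

Lemma num_components_petrial :
  num_components (partial_petrial A G) = num_components G.
Proof.
apply: num_components_relabel; try exact: petrie_cornerJ.
by move=> e; rewrite /petrial_turn; case: ifP.
Qed.

End TwistedCounts.

Lemma num_verticesE (E : finType) (G : ribbon_graph E) :
  num_vertices G = num_circuits G (fun=> (false, true)).
Proof.
apply/eq_n_comp/eq_connect/eq_joined_by; rewrite /= andbT.
by apply/andP; split; apply/forallP=> x //; rewrite across_turn.
Qed.

(** The value [(false, true)] skips an edge, [(true, false)] follows its free sides, and
    [(true, true)] follows them after a half-twist. *)
Definition cover_turn (E : finType) (A : {set E}) (d d' : bool * bool) e :=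
  if e \in A then d else d'.

Lemma boundary_relE (E : finType) (G : ribbon_graph E) (F : {set E}) :
  @boundary_rel E G F =2
    @circuit_rel E G (cover_turn F (true, false) (false, true)).
Proof.
apply: eq_joined_by; rewrite /= andbT; apply/andP; split; apply/forallP=> x //.
by rewrite along_turn across_turn /turn /cover_turn; case: ifP.
Qed.

Lemma num_boundariesE (E : finType) (G : ribbon_graph E) :
  num_boundaries G = num_circuits G (fun=> (true, false)).
Proof.
rewrite /num_boundaries (eq_n_comp (eq_connect (boundary_relE _))).
by apply: eq_num_circuits => e; rewrite /cover_turn inE.
Qed.

Lemma euler_genus_dual_petrial (E : finType) (G : ribbon_graph E) (A : {set E}) :
  euler_genus (twisted G [:: Delta; Tau] A) =
  (2 * (num_components G)%:Z
   - (num_circuits G (cover_turn A (true, false) (false, true)))%:Z + (#|E|)%:Z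
   - (num_circuits G (cover_turn A (true, true) (true, false)))%:Z)%R.
Proof.
rewrite /euler_genus num_verticesE num_boundariesE /=.
rewrite !num_circuits_petrial !num_circuits_dual.
rewrite num_components_petrial num_components_dual.
have v_turn : dual_turn A (petrial_turn A (fun=> (false, true)))
    =1 cover_turn A (true, false) (false, true).
  by move=> e; rewrite /petrial_turn /dual_turn /cover_turn; case: (e \in A).
have f_turn : dual_turn A (petrial_turn A (fun=> (true, false)))
    =1 cover_turn A (true, true) (true, false).
  by move=> e; rewrite /petrial_turn /dual_turn /cover_turn; case: (e \in A).
by rewrite (eq_num_circuits _ v_turn) (eq_num_circuits _ f_turn).
Qed.

Lemma euler_genus_dual_petrial_dual (E : finType) (G : ribbon_graph E)
    (A : {set E}) :
  euler_genus (twisted G [:: Delta; Tau; Delta] A) =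
  (2 * (num_components G)%:Z
   - (num_circuits G (cover_turn A (true, true) (false, true)))%:Z + (#|E|)%:Z
   - (num_circuits G (fun=> (true, false)))%:Z)%R.
Proof.
rewrite /euler_genus num_verticesE num_boundariesE /=.
rewrite !num_circuits_dual !num_circuits_petrial !num_circuits_dual.
rewrite num_components_dual num_components_petrial num_components_dual.
have v_turn : dual_turn A (petrial_turn A (dual_turn A (fun=> (false, true))))
    =1 cover_turn A (true, true) (false, true).
  by move=> e; rewrite /petrial_turn /dual_turn /cover_turn; case: (e \in A).
(* The Petrial fixes [(false, true)], so the two duals cancel. *)
have f_turn : dual_turn A (petrial_turn A (dual_turn A (fun=> (true, false))))
    =1 (fun=> (true, false)).
  by move=> e; rewrite /petrial_turn /dual_turn /cover_turn; case: (e \in A).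
by rewrite (eq_num_circuits _ v_turn) (eq_num_circuits _ f_turn).
Qed.

(** * Quasi-trees and spanning forests *)

Section QuasiTrees.
Variables (E : finType) (G : ribbon_graph E).
Implicit Types (A B F Q : {set E}).

Let sub_rel F : rel (point G) := @subgraph_rel E G F.
Let bd_turn F := cover_turn F (true, false) (false, true).

Lemma cover_turn_neq0 A d d' : d != (false, false) -> d' != (false, false) ->
  forall e, cover_turn A d d' e != (false, false).
Proof. by move=> d0 d'0 e; rewrite /cover_turn; case: ifP. Qed.

Lemma turn_cover A d d' x :
  turn (cover_turn A d d') x = turn (fun=> if x.1 \in A then d else d') x.
Proof. by []. Qed.

Lemma subgraph_sym F : connect_sym (sub_rel F).
Proof.
apply: joined_by_sym => -[e [i s]] /=; rewrite arcK /across /along /= !negbK.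
by case eF: (e \in F); rewrite /= ?eF ?negbK !eqxx.
Qed.

Lemma subgraph_arc F x : connect (sub_rel F) (inl x) (inl (arc G x)).
Proof. by apply: connect1; rewrite /sub_rel /subgraph_rel /joined_by /= eqxx. Qed.

Lemma subgraph_across F x : connect (sub_rel F) (inl x) (inl (across x)).
Proof.
by apply: connect1; rewrite /sub_rel /subgraph_rel /joined_by /= eqxx orbT.
Qed.

Lemma subgraph_along F x : x.1 \in F ->
  connect (sub_rel F) (inl x) (inl (along x)).
Proof.
move=> xF; apply: connect1.
by rewrite /sub_rel /subgraph_rel /joined_by /= xF eqxx !orbT.
Qed.

Lemma sub_subgraph F (r : rel (point G)) :
    (forall x, connect r (inl x) (inl (arc G x))) ->
    (forall x, connect r (inl x) (inl (across x))) ->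
    (forall x, x.1 \in F -> connect r (inl x) (inl (along x))) ->
  subrel (connect (sub_rel F)) (connect r).
Proof.
move=> r_arc r_across r_along; apply: sub_joined_by => x /=.
by rewrite r_arc r_across; case: ifP => [/r_along->|_]; rewrite ?connect0.
Qed.

Lemma circuit_sub_subgraph F (d : bool * bool) : d.1 ->
  subrel (connect (@circuit_rel E G (cover_turn F d (false, true))))
         (connect (sub_rel F)).
Proof.
case: d => [[] b] // _; apply: sub_joined_by => x /=.
rewrite subgraph_arc andbT /= turn_cover; case: ifP => xF; last first.
  by rewrite -across_turn subgraph_across.
have xalong := subgraph_along xF; case: b; last by rewrite -along_turn.
rewrite -across_along_turn; apply: connect_trans xalong _.
exact: subgraph_across.
Qed.

(** Boundary curves refine the components of (V(G), [F]), which refine those of [G]; the hypothesis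
    closes the chain, so the three partitions agree. *)
Lemma spanning_quasi_treeI F :
    subrel (connect (sub_rel setT)) (connect (@circuit_rel E G (bd_turn F))) ->
  spanning_quasi_tree G F.
Proof.
move=> sub p; have bdE := eq_connect (@boundary_relE E G F).
have bd_sub := @circuit_sub_subgraph F (true, false) isT.
have sub_setT : subrel (connect (sub_rel F)) (connect (sub_rel setT)).
  apply: sub_subgraph => x *; [exact: subgraph_arc | exact: subgraph_across |].
  by apply: subgraph_along; rewrite inE.
split.
  have eqc : connect (sub_rel setT) p =i connect (sub_rel F) p.
    by move=> q; apply/idP/idP => [/sub/bd_sub | /sub_setT].
  by rewrite (eq_n_comp_r eqc) n_comp_connect //; apply: subgraph_sym.
have eqc : connect (sub_rel setT) p =i connect (@circuit_rel E G (bd_turn F)) p.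
  by move=> q; apply/idP/idP => [/sub | /bd_sub/sub_setT].
by rewrite (eq_n_comp bdE) (eq_n_comp_r eqc) n_comp_connect //; apply: circuit_sym.
Qed.

(* Away from a quasi-tree, some edge meets two distinct boundary curves;
   toggling it merges them, which pays for any increase of c. *)
Lemma descent_to_quasi_tree (c : {set E} -> nat) :
    (forall A B e, (forall e', e' != e -> (e' \in A) = (e' \in B)) ->
      c A <= (c B).+1) ->
  forall B, exists Q, spanning_quasi_tree G Q /\
    num_circuits G (bd_turn Q) + c Q <= num_circuits G (bd_turn B) + c B.
Proof.
move=> cS B; have [n] := ubnP (num_circuits G (bd_turn B)).
elim: n B => // n IHn B /ltnSE Bn.
pose toggle e := [set e' | (e' \in B) (+) (e' == e)].
have toggleE e e' : e' != e -> (e' \in toggle e) = (e' \in B).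
  by move=> /negPf e'e; rewrite inE e'e addbF.
pose C := connect (@circuit_rel E G (bd_turn B)).
have [all_conn|] := boolP [forall x, C (inl x) (inl (turn (bd_turn (toggle x.1)) x))].
  exists B; split=> //; apply: spanning_quasi_treeI.
  (* The turn at a corner and its toggled version are [across] and [along] in some order, so one
     curve contains all corners of each edge. *)
  have tgl x := forallP all_conn x.
  have bd x : C (inl x) (inl (turn (bd_turn B) x)) by apply/connect1/circuit_turn.
  apply: sub_subgraph => x *; first exact/connect1/circuit_arc.
    have := tgl x; have := bd x; rewrite across_turn /bd_turn /turn /cover_turn.
    by rewrite inE eqxx addbT; case: (x.1 \in B).
  have := tgl x; have := bd x; rewrite along_turn /bd_turn /turn /cover_turn.
  by rewrite inE eqxx addbT; case: (x.1 \in B).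
case/forallPn=> x xC; pose B' := toggle x.1.
have ltB' : num_circuits G (bd_turn B') < num_circuits G (bd_turn B).
  apply: num_circuits_merge xC; try exact: cover_turn_neq0.
  by move=> e ex; rewrite /bd_turn /cover_turn toggleE.
have [Q [qtQ leQ]] := IHn B' (leq_trans ltB' Bn); exists Q; split=> //.
apply: leq_trans leQ _; rewrite -ltnS -addSn -addnS leq_add //.
exact: cS (toggleE x.1).
Qed.

(* An edge between distinct components of (V(G), F) joins two distinct boundary
   curves, and adding it merges them whether or not it is half-twisted. *)
Lemma spanning_forest : exists F,
  forall d : bool * bool, d.1 -> subrel (connect (sub_rel setT))
    (connect (@circuit_rel E G (cover_turn F d (false, true)))).
Proof.
(* Untwisted and half-twisted edges are treated at once; for [set0] the circuits are the vertex
   circles. *)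
pose good F := forall d : bool * bool, d.1 -> subrel (connect (sub_rel F))
    (connect (@circuit_rel E G (cover_turn F d (false, true)))).
have good0 : good set0.
  move=> d _; apply: sub_subgraph => x; first exact/connect1/circuit_arc.
    rewrite across_turn; rewrite (@eq_turn _ _ (cover_turn set0 d (false, true))).
      exact/connect1/circuit_turn.
    by rewrite /cover_turn inE.
  by rewrite inE.
suffices: forall n F, #|~: F| < n -> good F -> exists F', good F' /\
    forall x, connect (sub_rel F') (inl x) (inl (along x)).
  case/(_ _ _ (ltnSn _) good0)=> F [goodF alongF]; exists F => d d1 p q pq.
  apply: goodF => //; apply: sub_subgraph pq => x *; last exact: alongF.
    exact: subgraph_arc.
  exact: subgraph_across.
elim=> // n IHn F /ltnSE Fn goodF.
have [/forallP Fconn|] := boolP [forall x, connect (sub_rel F) (inl x) (inl (along x))].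
  by exists F.
case/forallPn=> x xF; have x1F : x.1 \notin F.
  by apply: contra xF; apply: subgraph_along.
apply: (IHn (x.1 |: F)) => [|d d1].
  apply: leq_trans Fn; rewrite proper_card // properC; apply/properP; split.
    exact: subsetUr.
  by exists x.1; rewrite // !inE eqxx.
have d0 : d != (false, false) by apply: contraTneq d1 => ->.
set u := cover_turn _ _ _.
have turn_new y : y.1 = x.1 -> turn u y = turn (fun=> d) y.
  by move=> yx; apply: eq_turn; rewrite /u /cover_turn yx setU11.
have xux : ~~ connect (@circuit_rel E G (cover_turn F d (false, true)))
    (inl x) (inl (turn u x)).
  apply: contra xF => /(circuit_sub_subgraph d1); rewrite turn_new //.
  case: d d1 {d0 u turn_new} => [[] []] // _; last by rewrite -along_turn.
  rewrite -across_along_turn => /connect_trans; apply.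
  by rewrite subgraph_sym subgraph_across.
have {xux} merged : subrel
    (connect (@circuit_rel E G (cover_turn F d (false, true))))
    (connect (@circuit_rel E G u)).
  apply: merge_circuits xux; try exact: cover_turn_neq0.
  by move=> e /negPf ex; rewrite /u /cover_turn in_setU1 ex.
(* At the new edge [u] no longer turns by [across]; the connection survives because merging only
   coarsens circuits. *)
have u_across y : connect (@circuit_rel E G u) (inl y) (inl (across y)).
  exact/merged/goodF/subgraph_across.
apply: sub_subgraph => y; first exact/connect1/circuit_arc.
  exact: u_across.
case/setU1P=> [yx|yF]; last exact/merged/goodF/subgraph_along.
have: connect (@circuit_rel E G u) (inl y) (inl (turn u y)).
  exact/connect1/circuit_turn.
rewrite turn_new //.
case: d d1 {d0 turn_new merged} @u u_across => [[] []] // _ u u_across.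
  rewrite -across_along_turn => /connect_trans; apply.
  by rewrite circuit_sym.
by rewrite -along_turn.
Qed.

End QuasiTrees.

(** * Attaining the maximal Euler genus *)

Lemma cover_turn_leS (E : finType) (G : ribbon_graph E) (d d' : bool * bool) :
    d != (false, false) -> d' != (false, false) -> forall (A B : {set E}) e,
    (forall e', e' != e -> (e' \in A) = (e' \in B)) ->
  num_circuits G (cover_turn A d d') <= (num_circuits G (cover_turn B d d')).+1.
Proof.
move=> d0 d'0 A B e AB; apply: (@num_circuits_leS _ _ _ _ e);
  try exact: cover_turn_neq0.
by move=> e' /AB; rewrite /cover_turn => ->.
Qed.

Lemma max_euler_genusP (E : finType) (G : ribbon_graph E) rho (Q : {set E}) :
    (forall B, euler_genus (twisted G rho B) <= euler_genus (twisted G rho Q))%R ->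
  euler_genus (twisted G rho Q) = max_euler_genus rho G.
Proof.
move=> maxQ; apply/le_anti/andP; split.
  exact: (le_bigmax _ (fun B => euler_genus (twisted G rho B))).
(* The default of the maximum is its value at [set0], so it obeys the same bound. *)
by apply/bigmax_leP.
Qed.

Theorem corollary5p2 (E : finType) (G : ribbon_graph E) (rho : seq twist)
    (hrho : rho = [:: Delta; Tau] \/ rho = [:: Delta; Tau; Delta]) :
  exists Q : {set E},
    spanning_quasi_tree G Q /\
    euler_genus (twisted G rho Q) = max_euler_genus rho G.
Proof.
case: hrho => ->.
  (* Vertices plus boundary components of the twisted graph: with components and edges fixed,
     minimal cost means maximal genus. *)
  pose cost A := num_circuits G (cover_turn A (true, false) (false, true))
    + num_circuits G (cover_turn A (true, true) (true, false)).
  (* Descent never raises the cost, so from a minimiser it reaches a quasi-tree that is a minimiser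
     too. *)
  have [Q0 _ minQ0] := arg_minnP (P := predT) cost (erefl : predT set0).
  have [//|Q [qtQ leQ]] := @descent_to_quasi_tree E G
    (fun A => num_circuits G (cover_turn A (true, true) (true, false))) _ Q0.
    exact: cover_turn_leS.
  exists Q; split=> //; apply: max_euler_genusP => B.
  have {minQ0 leQ} : cost Q <= cost B := leq_trans leQ (minQ0 B isT).
  rewrite !euler_genus_dual_petrial /cost.
  by move: (num_circuits _ _) (num_circuits _ _) (num_circuits _ _)
    (num_circuits _ _) => a b c d; lia.
have [F connF] := spanning_forest G; exists F; split.
  by apply: spanning_quasi_treeI; apply: connF.
apply: max_euler_genusP => B; rewrite !euler_genus_dual_petrial_dual.
set a := num_circuits G (cover_turn F _ _).
set b := num_circuits G (cover_turn B _ _).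
(* With half-twists, the circuits of [F] fill the components of [G], whereas those of [B] stay
   inside components. *)
suffices: a <= b by lia.
apply: n_comp_sub; try exact: circuit_sym.
move=> p q /circuit_sub_subgraph pq; apply: connF => //.
have := pq isT; apply: sub_subgraph => x *; first exact: subgraph_arc.
  exact: subgraph_across.
by apply: subgraph_along; rewrite inE.
Qed.
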